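(* Let $\Lambda\subset\mathbb{R}^2$ be open, $x=(x^1,x^2)$, $m\ge 2$, and let $\mathcal{M}(2)=[\mathcal{R}_{p,q}]_{1\le p,q\le m}$ with $$\mathcal{R}_{p,p}=f_{p,p,0,1}\mathrm{D}_{0,1}+f_{p,p,1,1}\mathrm{D}_{1,1}+f_{p,p,1,2}\mathrm{D}_{1,2}+f_{p,p,2,1}\mathrm{D}_{2,1}+f_{p,p,2,2}\mathrm{D}_{2,2}+f_{p,p,2,3}\mathrm{D}_{2,3}+f_{p,p,2,4}\mathrm{D}_{2,4},$$ $$\mathcal{R}_{p,q}=f_{p,q,0,1}\mathrm{D}_{0,1}+f_{p,q,1,1}\mathrm{D}_{1,1}+f_{p,q,1,2}\mathrm{D}_{1,2}\quad(p\ne q),$$ where $f_{p,q,k,h}\in\mathcal{C}(\Lambda,\mathbb{R})$. A necessary and sufficient condition for $\mathcal{M}(2)$ to be decomposed into the form $\mathcal{M}(2)=\mathcal{N}_1(1)\cdot\mathcal{N}_2(1)$, where for $i=1,2$, $\mathcal{N}_i(1)=[\mathcal{T}_{i,p,q}]_{1\le p,q\le m}$ with $$\mathcal{T}_{i,p,p}=a_{i,p,p,0,1}\mathrm{D}_{0,1}+a_{i,p,p,1,1}\mathrm{D}_{1,1}+a_{i,p,p,1,2}\mathrm{D}_{1,2},\qquad \mathcal{T}_{i,p,q}=a_{i,p,q,0,1}\mathrm{D}_{0,1}\ \ (p\ne q),$$ $a_{1,p,q,k,h}\in\mathcal{C}(\Lambda,\mathbb{R})$ and $a_{2,p,q,k,h}\in\mathcal{C}^1(\Lambda,\mathbb{R})$,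 is that these functions satisfy on $\Lambda$, with $\mathcal{L}_p=a_{1,p,p,1,1}\mathrm{D}_{1,1}+a_{1,p,p,1,2}\mathrm{D}_{1,2}$, for all $p\in\{1,\dots,m\}$, \begin{align*} f_{p,p,0,1}&=\sum_{l=1}^m a_{1,p,l,0,1}a_{2,l,p,0,1}+\mathcal{L}_p(a_{2,p,p,0,1}),\\ f_{p,p,1,1}&=a_{1,p,p,0,1}a_{2,p,p,1,1}+a_{1,p,p,1,1}a_{2,p,p,0,1}+\mathcal{L}_p(a_{2,p,p,1,1}),\\ f_{p,p,1,2}&=a_{1,p,p,0,1}a_{2,p,p,1,2}+a_{1,p,p,1,2}a_{2,p,p,0,1}+\mathcal{L}_p(a_{2,p,p,1,2}),\\ f_{p,p,2,1}&=a_{1,p,p,1,1}a_{2,p,p,1,1},\\ f_{p,p,2,2}+f_{p,p,2,3}&=a_{1,p,p,1,2}a_{2,p,p,1,1}+a_{1,p,p,1,1}a_{2,p,p,1,2},\\ f_{p,p,2,4}&=a_{1,p,p,1,2}a_{2,p,p,1,2}, \end{align*} and for all $p\ne q$ in $\{1,\dots,m\}$, \begin{align*} f_{p,q,0,1}&=\sum_{l=1}^m a_{1,p,l,0,1}a_{2,l,q,0,1}+\mathcal{L}_p(a_{2,p,q,0,1}),\\ f_{p,q,1,1}&=a_{1,p,p,1,1}a_{2,p,q,0,1}+a_{1,p,q,0,1}a_{2,q,q,1,1},\\ f_{p,q,1,2}&=a_{1,p,p,1,2}a_{2,p,q,0,1}+a_{1,p,q,0,1}a_{2,q,q,1,2}.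 \end{align*}
   Context: For scalar functions $w$ of $x=(x^1,x^2)$: $\mathrm{D}_{0,1}w=w$, $\mathrm{D}_{1,1}w=w_{x^1}$, $\mathrm{D}_{1,2}w=w_{x^2}$, $\mathrm{D}_{2,1}w=\frac{\partial^2w}{(\partial x^1)^2}$, $\mathrm{D}_{2,2}w=\frac{\partial}{\partial x^2}\frac{\partial w}{\partial x^1}$, $\mathrm{D}_{2,3}w=\frac{\partial}{\partial x^1}\frac{\partial w}{\partial x^2}$, $\mathrm{D}_{2,4}w=\frac{\partial^2w}{(\partial x^2)^2}$. A matrix operator acts on $u={}^t(u^1,\dots,u^m)$ by $\mathcal{M}(2)u=\big[\sum_{q=1}^m\mathcal{R}_{p,q}u^q\big]_{1\le p\le m}$ (similarly for $\mathcal{N}_i(1)$), and the product $\mathcal{N}_1(1)\cdot\mathcal{N}_2(1)$ is composition (the right factor acts first). Equality of operators means that both sides give the same result on every $u\in\mathcal{C}^2(\Lambda_0,\mathbb{R}^m)$, for open $\Lambda_0\subset\Lambda$. *)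

(* Defs.v *)
From HB Require Import structures.
From mathcomp Require Import all_boot all_order all_algebra.
From mathcomp Require Import all_classical all_reals all_analysis.
Set Implicit Arguments.
Unset Strict Implicit.
Unset Printing Implicit Defensive.

Import Order.TTheory GRing.Theory Num.Theory.
Import numFieldNormedType.Exports.
Local Open Scope classical_set_scope.
Local Open Scope ring_scope.

(* A function on an open set L of R^2 is represented by a total function
   'rV[R]_2 -> R: everything below only looks at points of L, where the
   derivatives depend only on the values of the function in L. *)

Section PartialDerivatives.
Variable R : realType.
Implicit Types (L : set 'rV[R]_2) (w : 'rV[R]_2 -> R).

(* The coordinate x^1 has index 0 and x^2 has index 1. *)
Definition partial (i : 'I_2) w : 'rV[R]_2 -> R :=
  fun x => 'D_(delta_mx 0 i) w x.

Definition D01 w : 'rV[R]_2 -> R := w.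
Definition D11 w := partial 0 w.
Definition D12 w := partial 1 w.
Definition D21 w := partial 0 (partial 0 w).
Definition D22 w := partial 1 (partial 0 w).
Definition D23 w := partial 0 (partial 1 w).
Definition D24 w := partial 1 (partial 1 w).

Definition C0on L w := {within L, continuous w}.

(* The derivability clause is needed because 'D is a total operator. *)
Definition C1on L w :=
  C0on L w /\
  forall i : 'I_2, (forall x, L x -> derivable w x (delta_mx 0 i)) /\
                   C0on L (partial i w).

Definition C2on L w := C1on L w /\ forall i : 'I_2, C1on L (partial i w).

End PartialDerivatives.

Section MatrixOperators.
Variables (R : realType) (m : nat).
Implicit Types (L : set 'rV[R]_2) (u : 'I_m -> 'rV[R]_2 -> R).

(* Fields with a single matrix index belong to the diagonal entries (p, p). *)
Record coeffs1 := Coeffs1 {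
  a01 : 'I_m -> 'I_m -> 'rV[R]_2 -> R;
  a11 : 'I_m -> 'rV[R]_2 -> R;
  a12 : 'I_m -> 'rV[R]_2 -> R }.

Record coeffs2 := Coeffs2 {
  f01 : 'I_m -> 'I_m -> 'rV[R]_2 -> R;
  f11 : 'I_m -> 'I_m -> 'rV[R]_2 -> R;
  f12 : 'I_m -> 'I_m -> 'rV[R]_2 -> R;
  f21 : 'I_m -> 'rV[R]_2 -> R;
  f22 : 'I_m -> 'rV[R]_2 -> R;
  f23 : 'I_m -> 'rV[R]_2 -> R;
  f24 : 'I_m -> 'rV[R]_2 -> R }.

Definition coeffs1_all (P : ('rV[R]_2 -> R) -> Prop) (a : coeffs1) :=
  [/\ forall p q, P (a01 a p q), forall p, P (a11 a p)
    & forall p, P (a12 a p)].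

Definition coeffs2_all (P : ('rV[R]_2 -> R) -> Prop) (f : coeffs2) :=
  [/\ forall p q, P (f01 f p q), forall p q, P (f11 f p q)
    & forall p q, P (f12 f p q)] /\
  [/\ forall p, P (f21 f p), forall p, P (f22 f p), forall p, P (f23 f p)
    & forall p, P (f24 f p)].

Definition T_entry (a : coeffs1) (p q : 'I_m) (w : 'rV[R]_2 -> R) :
    'rV[R]_2 -> R := fun x =>
  if p == q then
    a01 a p p x * D01 w x + a11 a p x * D11 w x + a12 a p x * D12 w x
  else a01 a p q x * D01 w x.

Definition R_entry (f : coeffs2) (p q : 'I_m) (w : 'rV[R]_2 -> R) :
    'rV[R]_2 -> R := fun x =>
  if p == q then
    f01 f p p x * D01 w x + f11 f p p x * D11 w x + f12 f p p x * D12 w x +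
    f21 f p x * D21 w x + f22 f p x * D22 w x +
    f23 f p x * D23 w x + f24 f p x * D24 w x
  else
    f01 f p q x * D01 w x + f11 f p q x * D11 w x + f12 f p q x * D12 w x.

Definition N_op (a : coeffs1) u : 'I_m -> 'rV[R]_2 -> R :=
  fun p x => \sum_(q < m) T_entry a p q (u q) x.

Definition M_op (f : coeffs2) u : 'I_m -> 'rV[R]_2 -> R :=
  fun p x => \sum_(q < m) R_entry f p q (u q) x.

Definition op_eq L (A B : ('I_m -> 'rV[R]_2 -> R) -> 'I_m -> 'rV[R]_2 -> R) :=
  forall L0 : set 'rV[R]_2, open L0 -> L0 `<=` L ->
  forall u, (forall q, C2on L0 (u q)) ->
  forall p x, L0 x -> A u p x = B u p x.

Definition L_op (a : coeffs1) (p : 'I_m) (w : 'rV[R]_2 -> R) :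
    'rV[R]_2 -> R :=
  fun x => a11 a p x * D11 w x + a12 a p x * D12 w x.

End MatrixOperators.

(* Main.v *)
Require Import Defs.
From HB Require Import structures.
From mathcomp Require Import all_boot all_order all_algebra.
From mathcomp Require Import all_classical all_reals all_analysis.
From mathcomp Require Import ring lra.
Import Order.TTheory GRing.Theory Num.Theory.
Import numFieldNormedType.Exports.
Local Open Scope classical_set_scope.
Local Open Scope ring_scope.

(** Composing two first-order systems and applying the Leibniz rule to the
    inner one gives again a second-order system, with coefficients
    [comp_coeffs a1 a2] ([N_op_comp]); no second-order term leaves the diagonal
    because only diagonal entries contain derivatives.  Hence the question is
    when two second-order operators [M_op f] and [M_op g] agree on all C^2
    vectors, and the answer ([M_op_eqP]) is: exactly when their coefficients
    agree pointwise, except that f22 and f23 are constrained only through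
    their sum.  The conditions of the theorem are this answer for
    [g := comp_coeffs a1 a2], split into the cases p = q and p <> q.

    Sufficiency in [M_op_eqP] is the symmetry of second derivatives
    ([derive_comm], [D22_eq_D23]), which lets f22 and f23 be added up.
    Necessity is a pointwise test: at each point x and for each prescribed
    2-jet there is a quadratic polynomial centred at x that has this jet
    ([jet_poly]), so evaluating both operators at x on a vector with one such
    component reads off each coefficient, and only the sum of f22 and f23
    since the mixed derivatives of the polynomial coincide. *)

(** * Symmetry of second directional derivatives *)

Lemma is_derive_along (R : numFieldType) (V W : normedModType R)
    (f : V -> W) (a v : V) (t : R) :
  derivable f (a + t *: v) v ->
  is_derive t (1 : R) (fun s => f (a + s *: v)) ('D_v f (a + t *: v)).
Proof.
move=> df.
have E : (fun h : R => h^-1 *: (((fun s => f (a + s *: v)) \o shift t) (h *: 1)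
      - f (a + t *: v))) =
    (fun h => h^-1 *: ((f \o shift (a + t *: v)) (h *: v) - f (a + t *: v))).
  by apply/funext => h /=; rewrite scaler1 scalerDl addrCA.
by split; rewrite ?/derivable ?/derive E.
Qed.

(** Applying the mean value theorem to the difference of f between two parallel
    segments directed by u, and then to the derivative of f in the direction u
    along a segment directed by v, turns the second difference, which is
    symmetric in u and v, into a value of a mixed derivative. *)
Lemma second_difference_mvt (R : realType) (V : normedModType R) (f : V -> R)
    (x u v : V) (h : R) : 0 < h ->
  (forall s t, 0 <= s <= h -> 0 <= t <= h ->
     derivable f (x + s *: u + t *: v) u /\
     derivable ('D_u f) (x + s *: u + t *: v) v) ->
  exists s t, [/\ 0 <= s <= h, 0 <= t <= h &
    f (x + h *: u + h *: v) - f (x + h *: u) - f (x + h *: v) + f x =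
    h ^+ 2 * 'D_v ('D_u f) (x + s *: u + t *: v)].
Proof.
move=> h0 df.
have h0h : 0 <= (0 : R) <= h by rewrite lexx ltW.
have hhh : 0 <= h <= h by rewrite lexx ltW.
pose g s := f (x + h *: v + s *: u) - f (x + s *: u).
pose dg s := 'D_u f (x + h *: v + s *: u) - 'D_u f (x + s *: u).
have g' s : s \in `[0, h] -> is_derive s (1 : R) g (dg s).
  rewrite in_itv/= => sh.
  apply: is_deriveB; apply: is_derive_along.
    by rewrite addrAC; exact: (df s h sh hhh).1.
  by have := (df s 0 sh h0h).1; rewrite scale0r addr0.
have cg : {within `[0, h], continuous g}.
  by apply: derivable_within_continuous => s /g' [].
have [s sh Eg] := MVT h0 (fun s sh => g' s (subset_itv_oo_cc sh)) cg.
have {}sh : 0 <= s <= h by move: sh; rewrite in_itv/= => /andP[] /ltW-> /ltW->.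
pose k t := 'D_u f (x + s *: u + t *: v).
pose dk t := 'D_v ('D_u f) (x + s *: u + t *: v).
have k' t : t \in `[0, h] -> is_derive t (1 : R) k (dk t).
  by rewrite in_itv/= => th; apply: is_derive_along; exact: (df s t sh th).2.
have ck : {within `[0, h], continuous k}.
  by apply: derivable_within_continuous => t /k' [].
have [t th Ek] := MVT h0 (fun t th => k' t (subset_itv_oo_cc th)) ck.
have {}th : 0 <= t <= h by move: th; rewrite in_itv/= => /andP[] /ltW-> /ltW->.
exists s, t; split => //.
move: Ek Eg; rewrite /k /g /dg -/(dk t) !scale0r !addr0 !subr0.
rewrite [x + h *: v + s *: u]addrAC [x + h *: v + h *: u]addrAC => ->.
by rewrite expr2 => E; lra.
Qed.

(** The second difference over a small parallelogram is h^2 times a value of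
    either mixed derivative; as the parallelogram shrinks to x, continuity at x
    forces the two limits to coincide. *)
Lemma derive_comm (R : realType) (V : normedModType R) (f : V -> R)
    (x u v : V) :
  (\forall y \near x, [/\ derivable f y u, derivable f y v,
     derivable ('D_u f) y v & derivable ('D_v f) y u]) ->
  {for x, continuous ('D_v ('D_u f))} ->
  {for x, continuous ('D_u ('D_v f))} ->
  'D_v ('D_u f) x = 'D_u ('D_v f) x.
Proof.
move=> df cvu cuv; apply/eqP; rewrite -subr_eq0 -normr_le0.
apply/ler_addgt0Pl => e e0; rewrite addr0.
have e2 : 0 < e / 2 by rewrite divr_gt0.
move/cvgrPdist_lt: cvu => /(_ _ e2) cvu.
move/cvgrPdist_lt: cuv => /(_ _ e2) cuv.
have fx : Filter (nbhs x) by typeclasses eauto.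
have nP := @filterI _ _ fx _ _ df (@filterI _ _ fx _ _ cvu cuv).
have [r /= r0 Br] := proj1 (nbhs_ballP _ _) nP.
(* With this h the parallelogram x + [0, h] u + [0, h] v lies in the ball. *)
pose h := r / (`|u| + `|v| + 1).
have n0 : 0 < `|u| + `|v| + 1 by rewrite ltr_wpDl ?addr_ge0.
have h0 : 0 < h by rewrite divr_gt0.
have inB s t : 0 <= s <= h -> 0 <= t <= h -> ball x r (x + s *: u + t *: v).
  move=> /andP[s0 sh] /andP[t0 th].
  rewrite -ball_normE /ball_ /= -addrA opprD addrA subrr sub0r normrN.
  rewrite (le_lt_trans (ler_normD _ _))// !normrZ !ger0_norm//.
  apply: (@le_lt_trans _ _ (h * (`|u| + `|v|))).
    by rewrite mulrDr lerD// ler_wpM2r.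
  have -> : r = h * (`|u| + `|v| + 1) by rewrite /h divfK// gt_eqF.
  by rewrite ltr_pM2l// ltrDl.
have inB' s t : 0 <= s <= h -> 0 <= t <= h -> ball x r (x + s *: v + t *: u).
  by move=> sh th; rewrite addrAC; exact: inB.
have [|s [t [sh th E1]]] := @second_difference_mvt _ _ f x u v h h0.
  by move=> s t sh th; have [[]] := Br _ (inB s t sh th).
have [|s' [t' [sh' th' E2]]] := @second_difference_mvt _ _ f x v u h h0.
  by move=> s' t' sh' th'; have [[]] := Br _ (inB' s' t' sh' th').
have [_ [B1 _]] := Br _ (inB s t sh th).
have [_ [_ B2]] := Br _ (inB' s' t' sh' th').
rewrite [x + h *: v + h *: u]addrAC in E2.
move: ('D_v ('D_u f) x) ('D_u ('D_v f) x)
  ('D_v ('D_u f) (x + s *: u + t *: v)) ('D_u ('D_v f) (x + s' *: v + t' *: u))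
  E1 E2 B1 B2 => A C B B'.
move: (f (x + h *: u + h *: v)) (f (x + h *: u)) (f (x + h *: v)) (f x).
move=> f11 f10 f01 f00 E1 E2 B1 B2.
have h2 : h ^+ 2 != 0 by rewrite expf_neq0// gt_eqF.
have E : B = B'.
  by apply: (mulfI h2); rewrite -E1 -E2; congr (_ + _); exact: addrAC.
rewrite -E distrC in B2.
by rewrite [e]splitr (le_trans (ler_distD B _ _))// lerD// ltW.
Qed.

(** * Quadratic polynomials with a prescribed 2-jet *)

Section Jets.
Context {R : realType}.
Implicit Types x y v : 'rV[R]_2.

Lemma ord2_cases (i : 'I_2) : i = 0 \/ i = 1.
Proof. by case: i => [[|[|//]] ?]; [left|right]; exact/val_inj. Qed.

Definition coord_from x (i : 'I_2) : 'rV[R]_2 -> R := fun y => y 0 i - x 0 i.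

Lemma is_derive_coord_from x i y v : is_derive y v (coord_from x i) (v 0 i).
Proof.
have E : \forall h \near 0^', h^-1 *: ((coord_from x i \o shift y) (h *: v)
    - coord_from x i y) = v 0 i.
  near=> h; rewrite /= /coord_from !mxE.
  have h0 : h != 0 by near: h; exact: nbhs_dnbhs_neq.
  rewrite (_ : _ - _ = h * v 0 i); last by ring.
  by rewrite /GRing.scale/= mulKf.
have C : h^-1 *: ((coord_from x i \o shift y) (h *: v) - coord_from x i y)
    @[h --> 0^'] --> v 0 i.
  apply: cvg_trans (near_eq_cvg _) (cvg_cst (v 0 i)).
  by near=> h; apply/esym; near: h.
split; first by apply/cvg_ex; exists (v 0 i).
exact: cvg_lim.
Unshelve. all: by end_near. Qed.

Lemma continuous_coord_from x i : continuous (coord_from x i).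
Proof.
by move=> y; apply: continuousB; [exact: coord_continuous|exact: cst_continuous].
Qed.

(** The Taylor polynomial at x whose value is c, whose first derivatives are b0
    and b1, and whose second derivatives are a00, a01 and a11.  With this
    normalisation differentiating only shifts the parameters. *)
Definition jet_poly x (c b0 b1 a00 a01 a11 : R) : 'rV[R]_2 -> R :=
  cst c + cst b0 * coord_from x 0 + cst b1 * coord_from x 1
  + cst (a00 / 2) * (coord_from x 0 * coord_from x 0)
  + cst a01 * (coord_from x 0 * coord_from x 1)
  + cst (a11 / 2) * (coord_from x 1 * coord_from x 1).

Lemma continuous_jet_poly x c b0 b1 a00 a01 a11 :
  continuous (jet_poly x c b0 b1 a00 a01 a11).
Proof.
move=> y; have := @continuous_coord_from x 0 y.
have := @continuous_coord_from x 1 y => c1 c0.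
have cc d : {for y, continuous (cst d : 'rV[R]_2 -> R)}.
  exact: cst_continuous.
have cM (f g : 'rV[R]_2 -> R) : {for y, continuous f} ->
  {for y, continuous g} -> {for y, continuous (f * g)} by exact: continuousM.
exact: (continuousD (continuousD (continuousD (continuousD (continuousD
  (cc c) (cM _ _ (cc b0) c0)) (cM _ _ (cc b1) c1))
  (cM _ _ (cc (a00 / 2)) (continuousM c0 c0)))
  (cM _ _ (cc a01) (continuousM c0 c1)))
  (cM _ _ (cc (a11 / 2)) (continuousM c1 c1))).
Qed.

Lemma is_derive_jet_poly x c b0 b1 a00 a01 a11 y v :
  is_derive y v (jet_poly x c b0 b1 a00 a01 a11)
    (jet_poly x b0 a00 a01 0 0 0 y * v 0 0
     + jet_poly x b1 a01 a11 0 0 0 y * v 0 1).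
Proof.
have D0 := is_derive_coord_from x 0 y v.
have D1 := is_derive_coord_from x 1 y v.
have DZ d (g : 'rV[R]_2 -> R) dg : is_derive y v g dg ->
    is_derive y v (cst d * g) (d * dg).
  move=> Dg; have := is_deriveM (is_derive_cst d y v) Dg.
  by rewrite scaler0 addr0.
have D := is_deriveD (is_deriveD (is_deriveD (is_deriveD (is_deriveD
  (is_derive_cst c y v) (DZ b0 _ _ D0)) (DZ b1 _ _ D1))
  (DZ (a00 / 2) _ _ (is_deriveM D0 D0))) (DZ a01 _ _ (is_deriveM D0 D1)))
  (DZ (a11 / 2) _ _ (is_deriveM D1 D1)).
apply: (is_derive_eq D).
by rewrite /jet_poly !fctE /= /GRing.scale /=; field.
Qed.

Lemma partial_jet_poly0 x c b0 b1 a00 a01 a11 :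
  partial 0 (jet_poly x c b0 b1 a00 a01 a11) = jet_poly x b0 a00 a01 0 0 0.
Proof.
apply/funext => y.
have [_ E] := is_derive_jet_poly x c b0 b1 a00 a01 a11 y (delta_mx 0 0).
by rewrite /partial E !mxE /= mulr1 mulr0 addr0.
Qed.

Lemma partial_jet_poly1 x c b0 b1 a00 a01 a11 :
  partial 1 (jet_poly x c b0 b1 a00 a01 a11) = jet_poly x b1 a01 a11 0 0 0.
Proof.
apply/funext => y.
have [_ E] := is_derive_jet_poly x c b0 b1 a00 a01 a11 y (delta_mx 0 1).
by rewrite /partial E !mxE /= mulr1 mulr0 add0r.
Qed.

Lemma jet_poly_center x c b0 b1 a00 a01 a11 :
  jet_poly x c b0 b1 a00 a01 a11 x = c.
Proof. by rewrite /jet_poly !fctE /= /coord_from !subrr; ring. Qed.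

Lemma C1on_jet_poly L x c b0 b1 a00 a01 a11 :
  C1on L (jet_poly x c b0 b1 a00 a01 a11).
Proof.
have C0 c' b0' b1' a00' a01' a11' :
    C0on L (jet_poly x c' b0' b1' a00' a01' a11').
  exact/continuous_subspaceT/continuous_jet_poly.
split; first exact: C0.
move=> i; split=> [y _|].
  by have [] := is_derive_jet_poly x c b0 b1 a00 a01 a11 y (delta_mx 0 i).
have [->|->] := ord2_cases i.
  by rewrite partial_jet_poly0.
by rewrite partial_jet_poly1.
Qed.

Lemma C2on_jet_poly L x c b0 b1 a00 a01 a11 :
  C2on L (jet_poly x c b0 b1 a00 a01 a11).
Proof.
split; first exact: C1on_jet_poly.
move=> i; have [->|->] := ord2_cases i.
  by rewrite partial_jet_poly0; exact: C1on_jet_poly.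
by rewrite partial_jet_poly1; exact: C1on_jet_poly.
Qed.

End Jets.

(** * Functions of class C^1 and C^2 *)

Lemma C1on_derivable {R : realType} {L : set 'rV[R]_2} {w x} i :
  L x -> C1on L w -> derivable w x (delta_mx 0 i).
Proof. by move=> Lx [_ /(_ i)[+ _]]; exact. Qed.

Lemma D22_eq_D23 {R : realType} (L : set 'rV[R]_2) w x :
  open L -> C2on L w -> L x -> D22 w x = D23 w x.
Proof.
move=> oL [hw hDw] Lx.
apply: derive_comm.
- near=> y; have Ly : L y by near: y; exact: open_nbhs_nbhs.
  by split; apply: (C1on_derivable _ Ly);
    [exact: hw|exact: hw|exact: hDw|exact: hDw].
- have [_ /(_ 1)[_ +]] := hDw 0; rewrite /C0on continuous_open_subspace//.
  by apply; rewrite inE.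
- have [_ /(_ 0)[_ +]] := hDw 1; rewrite /C0on continuous_open_subspace//.
  by apply; rewrite inE.
Unshelve. all: by end_near. Qed.

(** * Composition of two first-order operators *)

Section Ops.
Context {R : realType} {m : nat}.
Implicit Types (a : coeffs1 R m) (f : coeffs2 R m).
Implicit Types u : 'I_m -> 'rV[R]_2 -> R.

Lemma N_opE a u p : N_op a u p =
  \sum_(q < m) a01 a p q * u q
  + (a11 a p * D11 (u p) + a12 a p * D12 (u p)).
Proof.
apply/funext => x; rewrite /N_op !fctE fct_sumE /=.
have -> : \sum_q (a01 a p q * u q) x = \sum_q a01 a p q x * u q x by [].
rewrite (bigD1 p)//= [in RHS](bigD1 p)//= {1}/T_entry eqxx.
rewrite (eq_bigr (fun q => a01 a p q x * u q x)) => [|q].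
  by rewrite /D01; ring.
by rewrite eq_sym /T_entry => /negPf->.
Qed.

Lemma M_opE f u p x : M_op f u p x =
  \sum_(q < m) (f01 f p q x * u q x + f11 f p q x * D11 (u q) x
    + f12 f p q x * D12 (u q) x)
  + (f21 f p x * D21 (u p) x + f22 f p x * D22 (u p) x
     + f23 f p x * D23 (u p) x + f24 f p x * D24 (u p) x).
Proof.
rewrite /M_op (bigD1 p)//= [in RHS](bigD1 p)//= {1}/R_entry eqxx.
rewrite (eq_bigr (fun q => f01 f p q x * u q x + f11 f p q x * D11 (u q) x
    + f12 f p q x * D12 (u q) x)) => [|q].
  by rewrite /D01; ring.
by rewrite eq_sym /R_entry => /negPf->.
Qed.

(** The coefficients that the Leibniz rule produces.  In f11 and f12 the
    derivative of a leading coefficient of the inner operator appears on the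
    diagonal only, as that operator is of order 0 off the diagonal. *)
Definition comp_coeffs a1 a2 : coeffs2 R m := {|
  f01 := fun p q x => \sum_(l < m) a01 a1 p l x * a01 a2 l q x
           + L_op a1 p (a01 a2 p q) x;
  f11 := fun p q x => a01 a1 p q x * a11 a2 q x + a11 a1 p x * a01 a2 p q x
           + (if p == q then L_op a1 p (a11 a2 p) x else 0);
  f12 := fun p q x => a01 a1 p q x * a12 a2 q x + a12 a1 p x * a01 a2 p q x
           + (if p == q then L_op a1 p (a12 a2 p) x else 0);
  f21 := fun p x => a11 a1 p x * a11 a2 p x;
  f22 := fun p x => a12 a1 p x * a11 a2 p x;
  f23 := fun p x => a11 a1 p x * a12 a2 p x;
  f24 := fun p x => a12 a1 p x * a12 a2 p x |}.

Lemma partial_N_op a2 u p x i (e := delta_mx 0 i) :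
  (forall q, derivable (a01 a2 p q) x e) -> derivable (a11 a2 p) x e ->
  derivable (a12 a2 p) x e -> (forall q, derivable (u q) x e) ->
  derivable (D11 (u p)) x e -> derivable (D12 (u p)) x e ->
  partial i (N_op a2 u p) x =
    \sum_(q < m) (partial i (a01 a2 p q) x * u q x
                  + a01 a2 p q x * partial i (u q) x)
    + (partial i (a11 a2 p) x * D11 (u p) x
       + a11 a2 p x * partial i (D11 (u p)) x)
    + (partial i (a12 a2 p) x * D12 (u p) x
       + a12 a2 p x * partial i (D12 (u p)) x).
Proof.
move=> d01 d11 d12 du du1 du2.
have DS := is_derive_sum
  (fun q => is_deriveM (derivableP (d01 q)) (derivableP (du q))).
have D1 := is_deriveM (derivableP d11) (derivableP du1).
have D2 := is_deriveM (derivableP d12) (derivableP du2).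
have [_ E] := is_deriveD DS (is_deriveD D1 D2).
have comm (a b c d : R) : a * b + c * d = d * c + a * b.
  by rewrite addrC mulrC.
rewrite /partial N_opE [LHS]E addrA /GRing.scale/=.
by congr (_ + _ + _); [apply: eq_bigr => q _|..]; exact: comm.
Qed.

(** The finite-sum part of the composition, with the values at one point of all
    functions and derivatives abstracted to ring elements: C, E, F stand for the
    inner a01, a11, a12, the suffixes 1 and 2 for their partial derivatives, b1
    and b2 for the outer leading coefficients in row p, A for its row of a01,
    w for the vector acted upon, w1 and w2 for its first derivatives, and wij
    for the i-th derivative of the j-th derivative of its component p. *)
Lemma comp_sum_rearrange (K : comPzRingType) p (C : 'I_m -> 'I_m -> K)
    (A E F C1 C2 w w1 w2 : 'I_m -> K) (b1 b2 E1 E2 F1 F2 w11 w12 w21 w22 : K) :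
  \sum_q A q * (\sum_l C q l * w l + (E q * w1 q + F q * w2 q))
  + (b1 * (\sum_q (C1 q * w q + C p q * w1 q)
           + (E1 * w1 p + E p * w11) + (F1 * w2 p + F p * w12))
     + b2 * (\sum_q (C2 q * w q + C p q * w2 q)
           + (E2 * w1 p + E p * w21) + (F2 * w2 p + F p * w22))) =
  \sum_q ((\sum_l A l * C l q + (b1 * C1 q + b2 * C2 q)) * w q
    + (A q * E q + b1 * C p q + (if p == q then b1 * E1 + b2 * E2 else 0)) * w1 q
    + (A q * F q + b2 * C p q + (if p == q then b1 * F1 + b2 * F2 else 0)) * w2 q)
  + (b1 * E p * w11 + b2 * E p * w21 + b1 * F p * w12 + b2 * F p * w22).
Proof.
have E0 : \sum_q (\sum_l A l * C l q) * w q = \sum_q A q * (\sum_l C q l * w l).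
  under [RHS]eq_bigr do rewrite mulr_sumr.
  rewrite exchange_big/=; apply: eq_bigr => q _; rewrite mulr_suml.
  by apply: eq_bigr => l _; rewrite mulrA.
have diag X (G : 'I_m -> K) :
    \sum_q (if p == q then X else 0) * G q = X * G p.
  rewrite (bigD1 p)//= eqxx big1 ?addr0// => q.
  by rewrite eq_sym => /negPf->; rewrite mul0r.
transitivity (\sum_q (\sum_l A l * C l q) * w q
  + \sum_q (A q * (E q * w1 q + F q * w2 q)
      + b1 * (C1 q * w q + C p q * w1 q) + b2 * (C2 q * w q + C p q * w2 q)
      + (if p == q then b1 * E1 + b2 * E2 else 0) * w1 q
      + (if p == q then b1 * F1 + b2 * F2 else 0) * w2 q)
  + (b1 * E p * w11 + b2 * E p * w21 + b1 * F p * w12 + b2 * F p * w22)).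
  (* After splitting, [diag] collapses the sums of the diagonal corrections. *)
  rewrite E0 !big_split/= !diag -!mulr_sumr !big_split/=.
  under eq_bigr do rewrite mulrDr.
  by rewrite big_split/=; ring.
congr (_ + _); rewrite -big_split/=; apply: eq_bigr => q _.
by ring.
Qed.

(** The derivatives of [N_op a2 u] in row p involve second derivatives of the
    component p of u only, so the result has the shape of a second-order
    operator; the rest is collecting the coefficient of each derivative. *)
Lemma N_op_comp (L L0 : set 'rV[R]_2) a1 a2 u p x :
  coeffs1_all (C1on L) a2 -> (forall q, C2on L0 (u q)) -> L x -> L0 x ->
  N_op a1 (N_op a2 u) p x = M_op (comp_coeffs a1 a2) u p x.
Proof.
move=> [ha ha1 ha2] hu Lx L0x.
have dN i := partial_N_op a2 u p x i (fun q => C1on_derivable i Lx (ha p q))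
  (C1on_derivable i Lx (ha1 p)) (C1on_derivable i Lx (ha2 p))
  (fun q => C1on_derivable i L0x (hu q).1)
  (C1on_derivable i L0x ((hu p).2 0)) (C1on_derivable i L0x ((hu p).2 1)).
have NE (a : coeffs1 R m) w q : N_op a w q x = \sum_l a01 a q l x * w l x
    + (a11 a q x * D11 (w q) x + a12 a q x * D12 (w q) x).
  by rewrite N_opE !fctE fct_sumE.
rewrite M_opE NE [D11 (N_op _ _ _)]/D11 [D12 (N_op _ _ _)]/D12 !dN.
under eq_bigr do rewrite NE.
exact: comp_sum_rearrange.
Qed.

(** * Equality of second-order operators *)

(** On a vector whose q-th component is a quadratic polynomial and whose other
    components vanish, the value at the centre is the pairing of the
    coefficients of the entry (p, q) with the jet. *)
Lemma M_op_jet f x p q c b0 b1 c00 c01 c11 :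
  M_op f (fun k => let d := (k == q)%:R in
    jet_poly x (d * c) (d * b0) (d * b1) (d * c00) (d * c01) (d * c11)) p x =
  f01 f p q x * c + f11 f p q x * b0 + f12 f p q x * b1 +
  (p == q)%:R *
    (f21 f p x * c00 + (f22 f p x + f23 f p x) * c01 + f24 f p x * c11).
Proof.
rewrite M_opE /D11 /D12 /D21 /D22 /D23 /D24.
rewrite !(partial_jet_poly0, partial_jet_poly1) !jet_poly_center.
rewrite (bigD1 q)//= eqxx big1 => [|k /negPf kq]; last first.
  rewrite !(partial_jet_poly0, partial_jet_poly1) !jet_poly_center kq.
  by rewrite mulr0n !mul0r !mulr0 !addr0.
rewrite !(partial_jet_poly0, partial_jet_poly1) !jet_poly_center mulr1n.
by move: (p == q)%:R => d; ring.
Qed.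

(** Unit jets isolate the coefficients one at a time.  A jet has a single mixed
    second derivative, which is why f22 and f23 enter through their sum; for the
    converse, the symmetry of second derivatives does the same. *)
Lemma M_op_eqP (L : set 'rV[R]_2) f g : open L ->
  op_eq L (M_op f) (M_op g) <->
  forall x, L x ->
    (forall p q, [/\ f01 f p q x = f01 g p q x, f11 f p q x = f11 g p q x
      & f12 f p q x = f12 g p q x]) /\
    (forall p, [/\ f21 f p x = f21 g p x,
      f22 f p x + f23 f p x = f22 g p x + f23 g p x
      & f24 f p x = f24 g p x]).
Proof.
move=> oL; split=> [E x Lx|E L0 oL0 L0L u hu p x L0x].
  have J p q (c b0 b1 c00 c01 c11 : R) :=
    E L oL (@subset_refl _ L) (fun k => let d := (k == q)%:R in
      jet_poly x (d * c) (d * b0) (d * b1) (d * c00) (d * c01) (d * c11))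
      (fun k => C2on_jet_poly _ _ _ _ _ _ _ _) p x Lx.
  split=> [p q|p].
    have := J p q 1 0 0 0 0 0; have := J p q 0 1 0 0 0 0.
    have := J p q 0 0 1 0 0 0.
    by rewrite !M_op_jet !mulr0 !mulr1 !addr0 !add0r mulr0 !addr0.
  have := J p p 0 0 0 1 0 0; have := J p p 0 0 0 0 1 0.
  have := J p p 0 0 0 0 0 1.
  by rewrite !M_op_jet eqxx !mul1r !mulr0 !mulr1 !addr0 !add0r.
have [E1 /(_ p)[e21 e2 e24]] := E x (L0L x L0x).
rewrite !M_opE (D22_eq_D23 L0)// e21 e24.
congr (_ + _).
  by apply: eq_bigr => q _; have [-> -> ->] := E1 p q.
rewrite -!addrA; congr (_ + _); rewrite !addrA; congr (_ + _).
by rewrite -!mulrDl e2.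
Qed.

End Ops.

(** * The decomposition criterion *)

Theorem proposition2p6 (R : realType) (L : set 'rV[R]_2) (HL : open L)
  (m : nat) (hm : (2 <= m)%N)
  (f : coeffs2 R m) (Hf : coeffs2_all (C0on L) f)
  (a1 a2 : coeffs1 R m)
  (Ha1 : coeffs1_all (C0on L) a1) (Ha2 : coeffs1_all (C1on L) a2) :
  op_eq L (M_op f) (N_op a1 \o N_op a2) <->
  (forall x, L x ->
    (forall p : 'I_m,
      [/\ f01 f p p x =
            \sum_(l < m) a01 a1 p l x * a01 a2 l p x +
            L_op a1 p (a01 a2 p p) x,
          f11 f p p x =
            a01 a1 p p x * a11 a2 p x + a11 a1 p x * a01 a2 p p x +
            L_op a1 p (a11 a2 p) x
        & f12 f p p x =
            a01 a1 p p x * a12 a2 p x + a12 a1 p x * a01 a2 p p x +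
            L_op a1 p (a12 a2 p) x] /\
      [/\ f21 f p x = a11 a1 p x * a11 a2 p x,
          f22 f p x + f23 f p x =
            a12 a1 p x * a11 a2 p x + a11 a1 p x * a12 a2 p x
        & f24 f p x = a12 a1 p x * a12 a2 p x]) /\
    (forall p q : 'I_m, p != q ->
      [/\ f01 f p q x =
            \sum_(l < m) a01 a1 p l x * a01 a2 l q x +
            L_op a1 p (a01 a2 p q) x,
          f11 f p q x =
            a11 a1 p x * a01 a2 p q x + a01 a1 p q x * a11 a2 q x
        & f12 f p q x =
            a12 a1 p x * a01 a2 p q x + a01 a1 p q x * a12 a2 q x])).
Proof.
have -> : op_eq L (M_op f) (N_op a1 \o N_op a2) <->
    op_eq L (M_op f) (M_op (comp_coeffs a1 a2)).
  by split=> E L0 oL0 L0L u hu p x L0x; rewrite (E L0)//=;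
    rewrite (N_op_comp L L0)//; exact: L0L.
rewrite M_op_eqP//; split=> E x Lx; have {E} [E1 E2] := E x Lx; split.
- move=> p; have [e01 e11 e12] := E1 p p; split; last exact: E2.
  by move: e11 e12; rewrite /= eqxx.
- move=> p q pq; have [e01 e11 e12] := E1 p q.
  move: e11 e12; rewrite /= (negPf pq) !addr0 => -> ->; split=> //; exact: addrC.
- move=> p q /=; have [<-|pq] := eqVneq p q.
    by have [[]] := E1 p.
  by have [-> -> ->] := E2 p q pq; rewrite !addr0; split=> //; exact: addrC.
- by move=> p; have [_] := E1 p.
Qed.
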